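(* Let $k\ge2$, let $\theta=1$, and let the replacement matrix be the star matrix with central vertex $0$, $$R=\begin{pmatrix}\alpha_0&\alpha_1&\cdots&\alpha_{k-1}\\1&0&\cdots&0\\ \vdots&\vdots&\ddots&\vdots\\1&0&\cdots&0\end{pmatrix},\qquad \alpha_j\ge 0\ \text{for all } j,\quad \sum_{j=0}^{k-1}\alpha_j=1,$$ with $R\ne\begin{bmatrix}0&1\\1&0\end{bmatrix}$. Let $(U_n)_{n\ge 0}$ be the negative but linearly reinforced urn scheme with replacement matrix $R$, parameter $\theta=1$ and initial configuration $U_0$. Then $$\frac{U_{n,0}}{n+1}\longrightarrow 1\quad\text{a.s.}$$ Further, there exists a random variable $W\ge 0$ with $\mathbf E[W]>0$ such that $$\frac{U_{n,j}}{n^\gamma}\longrightarrow\frac{\alpha_j}{k-1}W\quad\text{a.s. for all } j=1,2,\dots,k-1,$$ where $\gamma=\frac{1-\alpha_0}{k-1}<1$.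
   Context: Model (for parameter $\theta=1$). Let $k\ge 2$ be an integer, $S=\{0,1,\dots,k-1\}$ the set of colours, $R=((R_{i,j}))_{0\le i,j\le k-1}$ a stochastic matrix (nonnegative entries, all row sums equal to $1$), and $U_0=(U_{0,j})_{0\le j\le k-1}$ a probability vector on $S$. The negative but linearly reinforced urn scheme with initial configuration $U_0$, replacement matrix $R$ and $\theta=1$ is the process $(U_n)_{n\ge0}$ of random row vectors $U_n=(U_{n,j})_{0\le j\le k-1}$ in $[0,\infty)^k$ defined recursively as follows. With $\mathcal F_n=\sigma(U_0,\dots,U_n)$, the random colour $Z_n\in S$ (the colour chosen at draw $n+1$) satisfies $$\mathbb P(Z_n=j\mid\mathcal F_n)=\frac{1}{k-1}\left(1-\frac{U_{n,j}}{n+1}\right),\quad 0\le j\le k-1,$$ and $U_{n+1}=U_n+\chi_{n+1}R$, where $\chi_{n+1}=(\mathbf 1(Z_n=j))_{0\le j\le k-1}$ is a row vector. (Then $\sum_j U_{n,j}=n+1$ for all $n$.)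
   Formalization: The ''Further'' part is claimed only when α_0=1 holds exactly if U_{0,0}=1: it is false if α_0=1 and U_{0,0}<1 (U_{n,j}=U_{0,j} is constant, claimed limit 0) and if α_0<1 and U_{0,0}=1 (then W=0 a.s.). *)

(* Defs.v *)
(* MathComp / MathComp-Analysis *)
From HB Require Import structures.
From mathcomp Require Import all_boot all_order all_algebra.
From mathcomp Require Import all_classical all_reals all_analysis.
Set Implicit Arguments.
Unset Strict Implicit.
Unset Printing Implicit Defensive.
Import Order.TTheory GRing.Theory Num.Theory.
Import numFieldNormedType.Exports.
Local Open Scope classical_set_scope.
Local Open Scope ring_scope.

Definition prob_vector (R : realType) (k : nat) (v : 'rV[R]_k) : Prop :=
  (forall j, 0 <= v ord0 j) /\ \sum_j v ord0 j = 1.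

(* The colour 0 of {0, .., k-1}. *)
Definition colour0 (k : nat) (hk : (2 <= k)%N) : 'I_k := Ordinal (ltnW hk).

(* Row c is a; every other row is the indicator of c. *)
Definition star_matrix (R : realType) (k : nat) (c : 'I_k) (a : 'rV[R]_k) :
    'M[R]_k :=
  \matrix_(i, j) if i == c then a ord0 j else (j == c)%:R.

(* g is a version of P(E | G), for a sub-sigma-algebra G. *)
Definition is_cond_prob (R : realType) (d : measure_display)
    (T : measurableType d) (P : probability T R)
    (G : set (set T)) (E : set T) (g : T -> R) : Prop :=
  [/\ forall B : set R, measurable B -> G (g @^-1` B),
      P.-integrable setT (EFin \o g) &
      forall A : set T, G A -> (P (E `&` A) = \int[P]_(w in A) (g w)%:E)%E].

(* sigma(U_0, .., U_n), generated by the coordinates of U_0, .., U_n. *)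
Definition natural_filtration (R : realType) (T : Type) (k : nat)
    (U : nat -> T -> 'rV[R]_k) (n : nat) : set (set T) :=
  <<s [set A | exists m (j : 'I_k), (m <= n)%N /\
         preimage_set_system setT (fun w => U m w ord0 j) measurable A] >>.

(* The negative but linearly reinforced urn scheme with theta = 1; Z n is the
   colour chosen at draw n + 1. Measurability of the U n is not assumed: it
   follows from that of the Z n. *)
Record neg_linear_urn (R : realType) (d : measure_display)
    (T : measurableType d) (P : probability T R) (k : nat) (M : 'M[R]_k)
    (u0 : 'rV[R]_k) (U : nat -> T -> 'rV[R]_k) (Z : nat -> T -> 'I_k) : Prop := {
  urn_init : forall w, U 0%N w = u0 ;
  urn_draw_measurable : forall n j, measurable [set w | Z n w = j] ;
  urn_draw_law : forall n j,
    is_cond_prob P (natural_filtration U n) [set w | Z n w = j]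
      (fun w => (k.-1)%:R^-1 * (1 - U n w ord0 j / n.+1%:R)) ;
  urn_step : forall n w,
    U n.+1 w = U n w + (\row_j (Z n w == j)%:R) *m M }.

(* Main.v *)
Require Import Defs.
From HB Require Import structures.
From mathcomp Require Import all_boot all_order all_algebra.
From mathcomp Require Import all_classical all_reals all_analysis.
From mathcomp Require Import measurable_realfun.
From mathcomp Require Import ring lra zify.
Import Order.TTheory GRing.Theory Num.Theory.
Import numFieldNormedType.Exports.
Local Open Scope classical_set_scope.
Local Open Scope ring_scope.

(** Write [c] for the central colour, [b = 1 - alpha_c], [h = k - 1], and let
    [Y_n = n + 1 - U_(n,c)] be the mass outside the centre.  A draw of [c] adds
    [b] to [Y], any other draw adds nothing, and [c] is drawn with conditional
    probability [Y_n / (h (n + 1))].  Hence [Y] is a linearly reinforced process: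
    its conditional mean is multiplied by [1 + g / (n + 1)] at each step, with
    [g = b / h = gamma], and [M_n = Y_n / a_n] is a nonnegative martingale for
    [a_n = prod_(1 <= i <= n) (1 + g / i)].  As [a_n] is asymptotic to a positive
    multiple of [n ^ g] ([growth_powR_cvg]), everything reduces to the almost sure
    convergence of [M] to a limit of positive mean
    ([linear_reinforcement_cvg]).  Each noncentral [U_(n,j)] is an affine function
    of [Y_n] with slope [alpha_j / b], which gives the second limit; and [g < 1]
    makes [Y_n / (n + 1)] vanish, which gives the first.

    The convergence of [M] is proved without the martingale convergence theorem.
    The variance of an increment of [M] is at most a constant times
    [1 / a_n - 1 / a_(n+1)]; increments being orthogonal, the sum telescopes and
    [E (M_n - M_m)^2 <= b y0 / a_m].  Along the grid [s_i = (i + 1) ^ q], with [q]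
    so large that [a_(s_i) >= (i + 1) ^ 4], the L1 norms of the increments are
    therefore summable.  So [M_(s_i)] converges almost surely, and it is dominated
    by an integrable variable, so that its limit keeps the mean [y0]
    ([ae_L1_cvg_of_summable_increments]).  Finally [Y] is nondecreasing in [n] and
    consecutive grid values of [a] have ratio tending to 1, so the convergence
    extends from the grid to all [n] ([cvg_ratio_of_grid]).

    When [b = 0] nothing ever moves outside the centre, and the limits are
    immediate. *)

Set Implicit Arguments.
Unset Strict Implicit.

(** * The normalising products *)

Definition growth (R : realType) (g : R) (n : nat) : R :=
  \prod_(i < n) (1 + g / i.+1%:R).

Lemma growthS (R : realType) (g : R) (n : nat) :
  growth g n.+1 = growth g n * (1 + g / n.+1%:R).
Proof. by rewrite /growth big_ord_recr. Qed.

Lemma growth_gt0 (R : realType) (g : R) (n : nat) :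
  0 <= g -> 0 < growth g n.
Proof.
move=> g0; apply: prodr_gt0 => i _.
by rewrite ltr_pwDl// divr_ge0.
Qed.

Lemma le_growth (R : realType) (g : R) (m n : nat) :
  0 <= g -> (m <= n)%N -> growth g m <= growth g n.
Proof.
move=> g0 /subnK <-; elim: (n - m)%N => [|i IH]//.
rewrite addSn growthS (le_trans IH)// ler_peMr ?lerDl ?divr_ge0//.
exact/ltW/growth_gt0.
Qed.

(** Convexity of the exponential between [0] and [ln (1 + x)]. *)
Lemma powR_1Dx_le (R : realType) (g x : R) :
  0 <= g <= 1 -> 0 <= x -> (1 + x) `^ g <= 1 + g * x.
Proof.
move=> /andP[g0 g1] x0.
have x1 : 0 < 1 + x by rewrite ltr_pwDl.
have := convex_expR (Itv01 g0 g1) (ln (1 + x)) 0.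
rewrite !convRE/= /unstable.onem mulr0 addr0 expR0 mulr1 lnK ?posrE//.
rewrite /powR gt_eqF// => /le_trans; apply.
by rewrite le_eqVlt; apply/orP; left; apply/eqP; ring.
Qed.

(** Compare factor by factor: [(1 + 1 / i) ^ g <= 1 + g / i]. *)
Lemma powR_le_growth (R : realType) (g : R) (n : nat) :
  0 <= g <= 1 -> n.+1%:R `^ g <= growth g n.
Proof.
move=> g01; have /andP[g0 _] := g01.
elim: n => [|n IH]; first by rewrite /growth big_ord0 powR1.
rewrite growthS.
have -> : n.+2%:R = n.+1%:R * (1 + n.+1%:R^-1) :> R.
  by rewrite mulrDr mulr1 divff// -natr1.
rewrite powRM// ?addr_ge0//.
by rewrite ler_pM ?powR_ge0// powR_1Dx_le.
Qed.

(** The quotient is nonincreasing, because [1 + x <= expR x] and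
    [ln (1 - x) <= - x], and it stays above 1 by [powR_le_growth].  (The limit is
    [1 / Gamma (1 + g)].) *)
Lemma growth_powR_cvg (R : realType) (g : R) : 0 <= g <= 1 ->
  exists2 rho : R, 0 < rho & growth g n / n%:R `^ g @[n --> \oo] --> rho.
Proof.
move=> g01; have /andP[g0 _] := g01.
pose r n := growth g n.+1 / n.+1%:R `^ g.
have r1 n : 1 <= r n.
  rewrite ler_pdivlMr ?powR_gt0// mul1r.
  rewrite (le_trans (powR_le_growth n g01))//; exact: le_growth.
have rn : nonincreasing_seq r.
  apply/nonincreasing_seqP => n; rewrite /r growthS.
  rewrite -mulrA ler_wpM2l// ?(ltW (growth_gt0 _ _))//.
  rewrite ler_pdivrMr ?powR_gt0// [leRHS]mulrC ler_pdivlMr ?powR_gt0//.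
  have -> : n.+1%:R = n.+2%:R * (1 + - n.+2%:R^-1) :> R.
    rewrite mulrDr mulr1 mulrN divff//.
    by rewrite -[in RHS](natr1 n.+1) addrK.
  have i1 : n.+2%:R^-1 < 1 :> R by rewrite invf_lt1// ltr1n.
  have i2 : 0 < 1 + - n.+2%:R^-1 :> R by rewrite subr_gt0.
  rewrite powRM// ?(ltW i2)// mulrCA -[leRHS]mulr1.
  rewrite ler_wpM2l ?powR_ge0//.
  have l1 : ln (1 - n.+2%:R^-1) <= - n.+2%:R^-1 :> R.
    by apply: le_ln1Dx; rewrite ltrN2.
  rewrite [X in _ * X](_ : _ = expR (g * ln (1 - n.+2%:R^-1))); last first.
    by rewrite /powR gt_eqF.
  rewrite (@le_trans _ _ (expR (g / n.+2%:R) * expR (g * - n.+2%:R^-1)))//.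
    apply: ler_pM; rewrite ?expR_ge0 ?addr_ge0 ?divr_ge0 ?expR_ge1Dx//.
    by rewrite ler_expR ler_wpM2l.
  by rewrite -expRD mulrN subrr expR0.
have rc : cvgn r by apply: nonincreasing_is_cvgn => //; exists 1 => _ [n _ <-].
exists (limn r).
  by rewrite (lt_le_trans ltr01)//; apply: limr_ge => //; exact: nearW.
by rewrite -(cvg_shiftS (fun n => growth g n / n%:R `^ g)).
Qed.

Lemma powRN_cvg0 (R : realType) (e : R) : 0 < e ->
  (n%:R `^ e)^-1 @[n --> \oo] --> (0 : R).
Proof.
move=> e0; rewrite -(cvg_shiftS (fun n => (n%:R `^ e)^-1)) /=.
have /cvg_at_rightP : (x `^ e : R) @[x --> (0 : R)^'+] --> (0 : R).
  exact: powR_cvg0.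
move=> /(_ (fun n => n.+1%:R^-1)) h.
rewrite (_ : (fun n => (n.+1%:R `^ e)^-1) = fun n => (n.+1%:R^-1 : R) `^ e).
  by apply: h; split; [move=> n; rewrite invr_gt0 | exact: cvg_harmonic].
by apply/funext => n; rewrite -[in RHS]powR_inv1// -powRrM mulN1r powRN.
Qed.

Lemma powR_div_cvg0 (R : realType) (g : R) : g < 1 ->
  n%:R `^ g / n.+1%:R @[n --> \oo] --> (0 : R).
Proof.
move=> g1; have h : 0 < 1 - g by rewrite subr_gt0.
apply: squeeze_cvgr (cvg_cst (0 : R)) (powRN_cvg0 h).
near=> n; have n0 : (0 < n)%N by near: n; exact: nbhs_infty_gt.
rewrite divr_ge0 ?powR_ge0//= powRB ?pnatr_eq0 -?lt0n ?n0 ?implybT//.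
by rewrite invf_div powRr1// ler_wpM2l ?powR_ge0// lef_pV2 ?posrE ?ltr0n// ler_nat.
Unshelve. all: by end_near. Qed.

(** Polynomial grids are sparse, yet the ratio of neighbouring points tends to 1:
    this is what makes them fit for [cvg_ratio_of_grid], where a geometric grid
    would fail. *)
Lemma growth_grid_cvg1 (R : realType) (g : R) (p : nat) :
  0 <= g <= 1 -> (0 < p)%N ->
  growth g (i.+2 ^ p) / growth g (i.+1 ^ p) @[i --> \oo] --> (1 : R).
Proof.
move=> g01 p0; have /andP[g0 g1] := g01.
have [rho rho0 hr] := growth_powR_cvg g01.
have grid_pinfty (m : nat) : ((i + m) ^ p)%N @[i --> \oo] --> \oo.
  apply/cvgnyPge => A; near=> i.
  have Ai : (A <= i)%N by near: i; exact: nbhs_infty_ge.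
  rewrite (leq_trans Ai)// (leq_trans (leq_addr m i))//.
  have [->//|im] := posnP (i + m); by rewrite -{1}[(i + m)%N]expn1 leq_pexp2l.
pose q (i : nat) := growth g (i ^ p) / (i ^ p)%:R `^ g.
have hq (m : nat) : q (i + m)%N @[i --> \oo] --> rho.
  exact: (cvg_comp _ _ (grid_pinfty m) hr).
have t1 : (1 + i.+1%:R^-1 : R) ^+ p @[i --> \oo] --> (1 : R).
  have t0 : (1 + i.+1%:R^-1 : R) @[i --> \oo] --> (1 : R).
    by rewrite -[X in _ --> X]addr0; apply: cvgD; [exact: cvg_cst | exact: cvg_harmonic].
  have /(_ (1 : R)) := @exprn_continuous R p.
  by rewrite /continuous_at expr1n => /(cvg_comp _ _ t0).
have t2 : ((1 + i.+1%:R^-1 : R) ^+ p) `^ g @[i --> \oo] --> (1 : R).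
  apply: squeeze_cvgr (cvg_cst (1 : R)) t1; apply: nearW => i /=.
  have h1 : 1 <= (1 + i.+1%:R^-1 : R) ^+ p.
    by rewrite exprn_ege1// lerDl.
  by rewrite ler1_powR// andbT -[leLHS](powRr0 ((1 + i.+1%:R^-1 : R) ^+ p)) ler_powR.
have rhon0 : rho != 0 by rewrite gt_eqF.
have one : rho / rho * 1 = 1 by rewrite divff// mulr1.
have H := cvgM (cvgM (hq 2%N) (cvgV rhon0 (hq 1%N))) t2; rewrite one in H.
suff -> : (fun i => growth g (i.+2 ^ p) / growth g (i.+1 ^ p)) =
  (fun i => q (i + 2)%N / q (i + 1)%N * ((1 + i.+1%:R^-1 : R) ^+ p) `^ g) by exact: H.
apply/funext => i; rewrite /q addn1 addn2.
have -> : 1 + i.+1%:R^-1 = i.+2%:R / i.+1%:R :> R.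
  by rewrite -[in RHS](natr1 i.+1) mulrDl mul1r divff.
rewrite expr_div_n powRM ?invr_ge0 ?exprn_ge0// -[(i.+1%:R ^+ p)^-1]powR_inv1 ?exprn_ge0//.
rewrite -powRrM mulN1r powRN !(natrX, natrM).
have x0 (j : nat) : (j.+1%:R ^+ p) `^ g != 0 :> R.
  by rewrite gt_eqF// powR_gt0// exprn_gt0.
have := growth_gt0 (i.+1 ^ p) g0; move=> /lt0r_neq0 gn0; field.
by rewrite !x0 gn0.
Unshelve. all: by end_near. Qed.

(** By monotonicity, for [s i <= n < s i.+1] the ratio at [n] lies between the
    ratios at [s i] and [s i.+1], up to a factor [a (s i.+1) / a (s i)]. *)
Lemma cvg_ratio_of_grid (R : realType) (y a : R ^nat) (s : nat -> nat) (l : R) :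
  nondecreasing_seq y -> 0 <= y 0%N ->
  nondecreasing_seq a -> 0 < a 0%N ->
  (forall i, s i < s i.+1)%N ->
  a (s i.+1) / a (s i) @[i --> \oo] --> (1 : R) ->
  y (s i) / a (s i) @[i --> \oo] --> l ->
  y n / a n @[n --> \oo] --> l.
Proof.
move=> ynd y0 and a0 sincr ha hy.
have yge n : 0 <= y n by rewrite (le_trans y0)// ynd.
have agt n : 0 < a n by rewrite (lt_le_trans a0)// and.
have sle : {homo s : i j / (i <= j)%N}.
  by apply: homo_leq => [//|? ? ?|i]; [exact: leq_trans | exact: ltnW].
have sloc n : exists i, (s 0 <= n)%N -> (s i <= n < s i.+1)%N.
  elim: n => [|n [i hi]].
    exists 0%N; rewrite leqn0 => /eqP s0.
    by apply/andP; split; [rewrite s0 | rewrite -{1}s0 sincr].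
  have [sn|sn] := leqP (s 0%N) n; last first.
    exists 0%N => sn1; have <- : s 0%N = n.+1 by apply/eqP; rewrite eqn_leq sn1.
    by rewrite leqnn sincr.
  have /andP[h1 h2] := hi sn.
  have [h3|h3] := leqP (s i.+1) n.+1; last by exists i => _; rewrite h3 leqW.
  by exists i.+1 => _; rewrite h3 (leq_ltn_trans h2).
(* [j n] is the grid cell of [n]; below the grid its value is arbitrary. *)
have [j hj] := choice sloc.
have jy : j n @[n --> \oo] --> \oo.
  apply/cvgnyPge => A; near=> n.
  have /andP[_] : (s (j n) <= n < s (j n).+1)%N.
    by apply: hj; near: n; exact: nbhs_infty_ge.
  have sAn : (s A <= n)%N by near: n; exact: nbhs_infty_ge.
  rewrite ltnNge; apply: contraNleq => jA; exact: leq_trans (sle _ _ jA) sAn.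
have lo : (y (s i) / a (s i)) / (a (s i.+1) / a (s i)) @[i --> \oo] --> l.
  rewrite -[X in _ --> X]divr1; exact: (cvgM hy (cvgV (oner_neq0 _) ha)).
have hyS : y (s i.+1) / a (s i.+1) @[i --> \oo] --> l.
  by rewrite (cvg_shiftS (fun i => y (s i) / a (s i))).
have hi : (y (s i.+1) / a (s i.+1)) * (a (s i.+1) / a (s i)) @[i --> \oo] --> l.
  by rewrite -[X in _ --> X]mulr1; exact: (cvgM hyS ha).
apply: squeeze_cvgr (cvg_comp _ _ jy lo) (cvg_comp _ _ jy hi).
near=> n.
have /andP[/= h1 h2] : (s (j n) <= n < s (j n).+1)%N.
  by apply: hj; near: n; exact: nbhs_infty_ge.
have e i : a i != 0 by rewrite gt_eqF.
rewrite invf_div mulrA divfK// mulrA divfK//.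
by apply/andP; split; apply: ler_pM => //; rewrite ?invr_ge0 ?(ltW (agt _))//
  ?lef_pV2 ?posrE// ?ynd ?and // ltnW.
Unshelve. all: by end_near. Qed.

(** * Almost sure convergence from summable L1 increments *)

(** The sum of the absolute increments has finite expectation, so it is almost
    surely finite; added to [X 0], it also dominates the whole sequence. *)
Lemma ae_L1_cvg_of_summable_increments (R : realType) (d : measure_display)
    (T : measurableType d) (P : probability T R) (X : nat -> T -> R)
    (iX : forall i, P.-integrable setT (EFin \o X i))
    (X0 : forall i w, 0 <= X i w)
    (sX : (\sum_(0 <= i <oo) \int[P]_w (`|X i.+1 w - X i w|)%:E < +oo)%E) :
  exists L : {RV P >-> R},
    [/\ forall w, 0 <= L w,
        {ae P, forall w, X i w @[i --> \oo] --> L w} &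
        (\int[P]_w (X i w)%:E)%E @[i --> \oo] --> ('E_P[L])%E].
Proof.
have mX i : measurable_fun setT (X i).
  by apply/measurable_EFinP; exact: measurable_int (iX i).
pose S w : \bar R := (\sum_(0 <= i <oo) (`|X i.+1 w - X i w|)%:E)%E.
have mD i : measurable_fun setT (fun w => (`|X i.+1 w - X i w|)%:E).
  by apply/measurable_EFinP; apply: measurableT_comp => //; exact: measurable_funB.
have S0 w : (0 <= S w)%E by apply: nneseries_ge0 => *; rewrite lee_fin.
have mS : measurable_fun setT S.
  by apply: ge0_emeasurable_sum => // *; rewrite lee_fin.
have iS : P.-integrable setT S.
  apply/integrableP; split => //.
  under eq_integral do rewrite gee0_abs//.
  by rewrite /S integral_nneseries// => *; rewrite lee_fin.
have psum w n : ((\sum_(0 <= i < n) `|X i.+1 w - X i w|)%:E <= S w)%E.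
  rewrite -sumEFin; apply: nneseries_lim_ge => *; by rewrite lee_fin.
have Xcv w : S w \is a fin_num -> cvgn (X ^~ w).
  move=> Sfin; have cs : cvgn (series (fun i => X i.+1 w - X i w)).
    apply: normed_cvg; apply: nondecreasing_is_cvgn.
      by apply: nondecreasing_series => *; exact: normr_ge0.
    exists (fine (S w)) => _ [n _ <-] /=.
    by rewrite -lee_fin fineK// /series/=; exact: psum.
  have -> : X ^~ w = (fun i => X 0%N w + series (fun i => X i.+1 w - X i w) i).
    by apply/funext => i; rewrite /series/= telescope_sumr// addrC subrK.
  exact: is_cvgD (is_cvg_cst _) cs.
(* The upper limit makes [L] measurable; the absolute value makes it
   nonnegative also off the set of convergence. *)
pose L w : R := `|fine (limn_esup (fun i => (X i w)%:E))|.
have mL : measurable_fun setT L.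
  do 2 apply: measurableT_comp => //; apply: measurable_fun_limn_esup => i.
  exact/measurable_EFinP.
have XL w : cvgn (X ^~ w) -> X i w @[i --> \oo] --> L w.
  move=> cX; rewrite /L.
  have cE : (X i w)%:E @[i --> \oo] --> (limn (X ^~ w))%:E.
    by apply: cvg_EFin => //; exact: nearW.
  have [_ ->] := cvg_limn_einf_sup cE.
  by rewrite /= ger0_norm//; apply: limr_ge => //; exact: nearW.
pose L' : {RV P >-> R} := HB.pack L (isMeasurableFun.Build _ _ _ _ L mL).
have aeL : {ae P, forall w, X i w @[i --> \oo] --> L' w}.
  have := integrable_ae measurableT iS; apply: filterS => w /(_ I) Sfin.
  exact/XL/Xcv.
exists L'; split => //; first by move=> w; exact: normr_ge0.
have ig : P.-integrable setT (fun w => (`|X 0%N w|)%:E + S w)%E.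
  apply: integrableD => //; have := iX 0%N; exact: integrable_abse.
have [] := @dominated_convergence _ _ _ P _ measurableT (fun i => EFin \o X i)
  (EFin \o L') (fun w => (`|X 0%N w|)%:E + S w)%E.
- by move=> i; exact/measurable_EFinP.
- exact/measurable_EFinP.
- by move: aeL; apply: filterS => w cX _; apply: cvg_EFin => //; exact: nearW.
- exact: ig.
- apply: nearW => w i _ /=; apply: le_trans (leeD2l _ (psum w i)).
  rewrite -EFinD lee_fin.
  have -> : X i w = X 0%N w + \sum_(0 <= j < i) (X j.+1 w - X j w).
    by rewrite telescope_sumr// addrC subrK.
  by rewrite (le_trans (ler_normD _ _))// lerD2l ler_norm_sum.
by move=> _ _; rewrite unlock.
Qed.

(** * Expectations of bounded random variables *)

(** Every variable of a finite stage of the urn is bounded, and boundedness,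
    unlike integrability, is stable under products; so expectations of
    polynomials in these variables can be expanded freely. *)
Definition bounded_rv (d : measure_display) (T : measurableType d)
    (R : realType) (f : T -> R) : Prop :=
  measurable_fun setT f /\ exists M : R, forall w, `|f w| <= M.

Section bounded_rv_theory.
Context (R : realType) (d : measure_display) (T : measurableType d).
Context (P : probability T R).
Implicit Types (f g : T -> R) (a : R).

Lemma bounded_rv_cst a : bounded_rv (fun _ : T => a).
Proof. by split; [exact: measurable_cst | exists `|a|]. Qed.

Lemma bounded_rvD f g :
  bounded_rv f -> bounded_rv g -> bounded_rv (fun w => f w + g w).
Proof.
move=> [mf [M fM]] [mg [N gN]]; split; first exact: measurable_funD.
by exists (M + N) => w; rewrite (le_trans (ler_normD _ _))// lerD.
Qed.

Lemma bounded_rvM f g :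
  bounded_rv f -> bounded_rv g -> bounded_rv (fun w => f w * g w).
Proof.
move=> [mf [M fM]] [mg [N gN]]; split; first exact: measurable_funM.
by exists (M * N) => w; rewrite normrM ler_pM.
Qed.

Lemma bounded_rvZ a f : bounded_rv f -> bounded_rv (fun w => a * f w).
Proof. by move=> bf; apply: bounded_rvM => //; exact: bounded_rv_cst. Qed.

Lemma bounded_rvB f g :
  bounded_rv f -> bounded_rv g -> bounded_rv (fun w => f w - g w).
Proof.
move=> bf bg; rewrite (_ : (fun _ => _) = (fun w => f w + -1 * g w)).
  by apply: bounded_rvD => //; exact: bounded_rvZ.
by apply/funext => w; rewrite mulN1r.
Qed.

Lemma bounded_rv_norm f : bounded_rv f -> bounded_rv (fun w => `|f w|).
Proof.
move=> [mf [M fM]]; split; first exact: measurableT_comp.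
by exists M => w; rewrite normr_id.
Qed.

Lemma bounded_rv_integrable f :
  bounded_rv f -> P.-integrable setT (EFin \o f).
Proof.
move=> [mf [M fM]]; apply: measurable_bounded_integrable => //.
  by rewrite (le_lt_trans (probability_le1 P measurableT)) ?ltry.
exists M; split; rewrite ?num_real // => x Mx y _ /=.
by rewrite (le_trans (fM y))// ltW.
Qed.

Lemma bounded_rv_indic (A : set T) : measurable A -> bounded_rv (\1_A : T -> R).
Proof.
move=> mA; split; first exact: measurable_indic.
by exists 1 => w; rewrite indicE; case: (_ \in _); rewrite ?normr1 ?normr0.
Qed.

Lemma bounded_rv_walk (Y I : nat -> T -> R) (y0 b : R) :
  (forall w, Y 0%N w = y0) -> (forall n w, Y n.+1 w = Y n w + b * I n w) ->
  (forall n, bounded_rv (I n)) -> forall n, bounded_rv (Y n).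
Proof.
move=> Y_init Y_step bI; elim=> [|n IH].
  by rewrite (_ : Y 0 = cst y0); [exact: bounded_rv_cst | exact/funext].
rewrite (_ : Y n.+1 = (fun w => Y n w + b * I n w)); last exact/funext.
by apply: bounded_rvD => //; exact: bounded_rvZ.
Qed.

Local Notation E f := (Rintegral P setT f).

Lemma bounded_rv_intE f : bounded_rv f ->
  (\int[P]_w (f w)%:E)%E = (E f)%:E.
Proof.
move=> /bounded_rv_integrable fi.
by rewrite fineK//; exact: integrable_fin_num.
Qed.

Lemma bounded_rv_E_cst a : E (fun=> a) = a.
Proof. by rewrite Rintegral_cst//= [X in fine X](probability_setT P) mulr1. Qed.

Lemma bounded_rv_ED f g : bounded_rv f -> bounded_rv g ->
  E (fun w => f w + g w) = E f + E g.
Proof. by move=> bf bg; rewrite RintegralD//; exact: bounded_rv_integrable. Qed.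

Lemma bounded_rv_EB f g : bounded_rv f -> bounded_rv g ->
  E (fun w => f w - g w) = E f - E g.
Proof. by move=> bf bg; rewrite RintegralB//; exact: bounded_rv_integrable. Qed.

Lemma bounded_rv_EZ a f : bounded_rv f -> E (fun w => a * f w) = a * E f.
Proof. by move=> bf; rewrite RintegralZl//; exact: bounded_rv_integrable. Qed.

Lemma bounded_rv_leE f g : bounded_rv f -> bounded_rv g ->
  (forall w, f w <= g w) -> E f <= E g.
Proof.
move=> bf bg fg; apply: le_Rintegral => //; exact: bounded_rv_integrable.
Qed.

End bounded_rv_theory.

(** * Linear reinforcement *)

(** [I n] is the indicator of the reinforcing event and [Y n / (h * n.+1%:R)] its
    conditional probability.  Of the conditional law only the correlations with
    the past values [Y m] are kept: they suffice, since every second moment below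
    is quadratic in [Y] and [I]. *)
Section linear_reinforcement.
Context (R : realType) (d : measure_display) (T : measurableType d).
Context (P : probability T R) (Y I : nat -> T -> R) (y0 b h : R).
Hypotheses (y0_ge0 : 0 <= y0) (b_gt0 : 0 < b) (h_gt0 : 0 < h).
Hypothesis bh1 : b / h <= 1.
Hypothesis Y_init : forall w, Y 0%N w = y0.
Hypothesis Y_step : forall n w, Y n.+1 w = Y n w + b * I n w.
Hypothesis I_measurable : forall n, measurable_fun setT (I n).
Hypothesis I01 : forall n w, I n w = 0 \/ I n w = 1.
Hypothesis I_mean : forall n,
  \int[P]_w I n w = \int[P]_w (Y n w / (h * n.+1%:R)).
Hypothesis I_corr : forall m n, (m <= n)%N ->
  \int[P]_w (I n w * Y m w) = \int[P]_w (Y n w / (h * n.+1%:R) * Y m w).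

Local Notation E f := (Rintegral P setT f).
Local Notation g := (b / h).
Let a : nat -> R := growth g.
Let p n w := Y n w / (h * n.+1%:R).
Let Q n w := I n w - p n w.
Let M n w := Y n w / a n.

Let g_ge0 : 0 <= g.
Proof. by rewrite divr_ge0 ?ltW. Qed.

Let g_itv : 0 <= g <= 1.
Proof. by rewrite g_ge0. Qed.

Let a_gt0 n : 0 < a n.
Proof. exact: growth_gt0. Qed.

Let I_ge0 n w : 0 <= I n w.
Proof. by have [->|->] := I01 n w. Qed.

Let bI n : bounded_rv (I n).
Proof.
split=> //; exists 1 => w; have [->|->] := I01 n w; rewrite ?normr0 ?normr1//.
Qed.

Let bY n : bounded_rv (Y n).
Proof. exact: bounded_rv_walk Y_init Y_step bI n. Qed.

Let Y_ge0 n w : 0 <= Y n w.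
Proof.
elim: n => [|n IH]; first by rewrite Y_init.
by rewrite Y_step addr_ge0// mulr_ge0// ltW.
Qed.

Let Y_nd w : nondecreasing_seq (Y ^~ w).
Proof.
by apply/nondecreasing_seqP => n; rewrite Y_step lerDl mulr_ge0// ltW.
Qed.

Let pE n : p n = (fun w => (h * n.+1%:R)^-1 * Y n w).
Proof. by apply/funext => w; rewrite /p mulrC. Qed.

Let bp n : bounded_rv (p n).
Proof. rewrite pE; exact: bounded_rvZ. Qed.

Let bQ n : bounded_rv (Q n).
Proof. exact: bounded_rvB. Qed.

Let ME n : M n = (fun w => (a n)^-1 * Y n w).
Proof. by apply/funext => w; rewrite /M mulrC. Qed.

Let bM n : bounded_rv (M n).
Proof. rewrite ME; exact: bounded_rvZ. Qed.

Let M_step n w : M n.+1 w = M n w + b / a n.+1 * Q n w.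
Proof.
have an : a n.+1 = a n * (1 + g / n.+1%:R) by exact: growthS.
have := lt0r_neq0 (a_gt0 n.+1); rewrite /M /Q /p Y_step an mulf_eq0 negb_or.
move=> /andP[an0 f0]; have h0 := lt0r_neq0 h_gt0.
have f1 : b + h * n.+1%:R != 0 by rewrite gt_eqF// addr_gt0// mulr_gt0.
have n0 : n.+1%:R != 0 :> R by [].
by field; rewrite nat1r n0 h0 addrC f1 an0.
Qed.

Let Q_mean0 n : E (Q n) = 0.
Proof. by rewrite bounded_rv_EB// I_mean subrr. Qed.

Let QY_mean0 m n : (m <= n)%N -> E (fun w => Q n w * Y m w) = 0.
Proof.
move=> mn; rewrite (_ : (fun _ => _) = fun w => I n w * Y m w - p n w * Y m w).
  by rewrite bounded_rv_EB ?I_corr ?subrr//; exact: bounded_rvM.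
by apply/funext => w; rewrite -mulrBl.
Qed.

Let M_mean n : E (M n) = y0.
Proof.
elim: n => [|n IH].
  rewrite (_ : M 0%N = fun=> y0) ?bounded_rv_E_cst//.
  by apply/funext => w; rewrite /M Y_init /a /growth big_ord0 divr1.
rewrite (_ : M n.+1 = fun w => M n w + b / a n.+1 * Q n w); last exact/funext.
by rewrite bounded_rv_ED ?bounded_rv_EZ ?Q_mean0 ?mulr0 ?addr0//; exact: bounded_rvZ.
Qed.

Let Y_mean n : E (Y n) = a n * y0.
Proof.
rewrite -(M_mean n) ME bounded_rv_EZ// mulrA divff ?mul1r// gt_eqF//.
Qed.

(* Discarding the nonnegative term [I * p] from [Q * Q = I - I * p - Q * p]. *)
Let Q_var n : E (fun w => Q n w * Q n w) <= a n * y0 / (h * n.+1%:R).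
Proof.
have bQp : bounded_rv (fun w => Q n w * p n w) by exact: bounded_rvM.
apply: (@le_trans _ _ (E (fun w => I n w - Q n w * p n w))).
  apply: bounded_rv_leE; [exact: bounded_rvM | exact: bounded_rvB |move=> w].
  have p_ge0 : 0 <= p n w by rewrite divr_ge0// mulr_ge0// ltW.
  by rewrite /Q; have [->|->] := I01 n w; lra.
rewrite bounded_rv_EB// (_ : E (fun w => Q n w * p n w) = 0); last first.
  rewrite (_ : (fun _ => _) = fun w => (h * n.+1%:R)^-1 * (Q n w * Y n w)).
    by rewrite bounded_rv_EZ ?QY_mean0 ?mulr0//; exact: bounded_rvM.
  by apply/funext => w; rewrite pE mulrCA.
by rewrite subr0 I_mean -Y_mean -/(p n) pE bounded_rv_EZ// mulrC.
Qed.

(* Orthogonality of the increments, and the identity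
   [1 / a_k - 1 / a_(k+1) = g / ((k + 1) a_(k+1))], which makes the variances
   telescope. *)
Let M_incr m n : (m <= n)%N ->
  E (fun w => (M n w - M m w) ^+ 2) <= b * y0 * ((a m)^-1 - (a n)^-1).
Proof.
move=> /subnK <-; elim: (n - m)%N => [|i IH].
  rewrite add0n subrr mulr0 (_ : (fun _ => _) = fun=> 0) ?bounded_rv_E_cst//.
  by apply/funext => w; rewrite subrr expr0n.
rewrite addSn; set k := (i + m)%N in IH *.
pose c : R := b / a k.+1.
have bMM j l : bounded_rv (fun w => M j w * M l w) by exact: bounded_rvM.
have bQM j l : bounded_rv (fun w => Q j w * M l w) by exact: bounded_rvM.
have bD : bounded_rv (fun w => M k w - M m w) by exact: bounded_rvB.
have bD2 : bounded_rv (fun w => (M k w - M m w) ^+ 2).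
  rewrite (_ : (fun _ => _) = fun w => (M k w - M m w) * (M k w - M m w)).
    exact: bounded_rvM.
  by apply/funext => w; rewrite expr2.
have bQ2 : bounded_rv (fun w => Q k w * Q k w) by exact: bounded_rvM.
have QM0 j : (j <= k)%N -> E (fun w => Q k w * M j w) = 0.
  move=> jk; rewrite (_ : (fun _ => _) = fun w => (a j)^-1 * (Q k w * Y j w)).
    by rewrite bounded_rv_EZ ?QY_mean0 ?mulr0//; exact: bounded_rvM.
  by apply/funext => w; rewrite ME mulrCA.
rewrite (_ : (fun _ => _) = fun w => (M k w - M m w) ^+ 2 +
  (2 * c * (Q k w * M k w - Q k w * M m w) + c ^+ 2 * (Q k w * Q k w))); last first.
  by apply/funext => w; rewrite M_step -/c; ring.
rewrite bounded_rv_ED//; last first.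
  by apply: bounded_rvD; apply: bounded_rvZ => //; exact: bounded_rvB.
rewrite bounded_rv_ED//; last 2 first.
- by apply: bounded_rvZ; exact: bounded_rvB.
- exact: bounded_rvZ.
rewrite !bounded_rv_EZ//; last exact: bounded_rvB.
rewrite bounded_rv_EB// !QM0// ?leq_addl// subrr mulr0 add0r.
rewrite [leRHS](_ : _ = b * y0 * ((a m)^-1 - (a k)^-1) +
  b * y0 * ((a k)^-1 - (a k.+1)^-1)); last by rewrite -mulrDr addrA subrK.
apply: lerD => //; apply: le_trans (ler_wpM2l (sqr_ge0 c) (Q_var k)) _.
have aS : a k.+1 = a k * (1 + g / k.+1%:R) by exact: growthS.
have hk : 0 < h * k.+1%:R by rewrite mulr_gt0.
have -> : (a k)^-1 - (a k.+1)^-1 = b / (h * k.+1%:R) / a k.+1.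
  have := lt0r_neq0 (a_gt0 k.+1); rewrite aS mulf_eq0 negb_or => /andP[ak f0].
  have f1 : b + h * k.+1%:R != 0 by rewrite gt_eqF// addr_gt0// mulr_gt0.
  have h0 := lt0r_neq0 h_gt0.
  have n0 : k.+1%:R != 0 :> R by [].
  by field; rewrite nat1r n0 h0 addrC f1 ak.
rewrite /c [leLHS](_ : _ = b * y0 * (b / (h * k.+1%:R) / a k.+1) * (a k / a k.+1)).
  rewrite ler_piMr//.
    by rewrite !mulr_ge0// ?invr_ge0 ?ltW.
  by rewrite ler_pdivrMr// mul1r; exact: le_growth.
by field; rewrite !gt_eqF.
Qed.

(* [q >= 4 / g] works, because [a n] is at least [n ^ g]. *)
Let grid_decay : exists q : nat, (0 < q)%N /\
  forall i, (a (i.+1 ^ q))^-1 <= (i.+1%:R ^+ 4)^-1.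
Proof.
have g_gt0 : 0 < g by rewrite divr_gt0.
have q4 : 0 <= 4 / g by rewrite divr_ge0// ltW.
have := archi_boundP q4; set q := Num.bound _ => hq; exists q; split.
  by rewrite -(ltr0n R) (le_lt_trans q4).
move=> i; rewrite lef_pV2 ?posrE ?exprn_gt0//.
apply: le_trans (powR_le_growth (i.+1 ^ q) g_itv).
rewrite -powR_mulrn//.
apply: (@le_trans _ _ ((i.+1 ^ q)%:R `^ g)); last first.
  by apply: ge0_ler_powR; rewrite ?nnegrE// ler_nat.
rewrite natrX -(powR_mulrn q)// -powRrM ler_powR ?ler1n//.
by rewrite -ler_pdivrMr// ltW.
Qed.

(** Almost sure convergence holds along a polynomial grid because the increments
    there are summable in L1, then everywhere because [Y] is nondecreasing. *)
Lemma linear_reinforcement_cvg : exists L : {RV P >-> R},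
  [/\ forall w, 0 <= L w,
      {ae P, forall w, Y n w / growth g n @[n --> \oo] --> L w} &
      ('E_P[L] = y0%:E)%E].
Proof.
have [q [q0 hq]] := grid_decay.
pose s i := (i.+1 ^ q)%N.
have ss i : (s i < s i.+1)%N by rewrite ltn_exp2r.
pose K := b * y0 + 1.
have K0 : 0 <= K by rewrite addr_ge0// mulr_ge0// ltW.
have bD i : bounded_rv (fun w => M (s i.+1) w - M (s i) w) by exact: bounded_rvB.
have absD i : E (fun w => `|M (s i.+1) w - M (s i) w|) <= K / i.+1%:R ^+ 2.
  set x : R := i.+1%:R; have x0 : 0 < x by [].
  have bD2 : bounded_rv (fun w => (M (s i.+1) w - M (s i) w) ^+ 2).
    rewrite (_ : (fun _ => _) =
      fun w => (M (s i.+1) w - M (s i) w) * (M (s i.+1) w - M (s i) w)).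
      exact: bounded_rvM.
    by apply/funext => w; rewrite expr2.
  (* [2 |D| <= x^2 D^2 + 1 / x^2], a weighted AM-GM that trades the L1 norm for
     the variance. *)
  apply: (@le_trans _ _ (E (fun w => x ^+ 2 * (M (s i.+1) w - M (s i) w) ^+ 2
      + (x ^+ 2)^-1))).
    apply: bounded_rv_leE.
    - exact: bounded_rv_norm.
    - by apply: bounded_rvD; [exact: bounded_rvZ | exact: bounded_rv_cst].
    - move=> w; rewrite -[(M _ w - _) ^+ 2]real_normK ?num_real//.
      set z := `|_|; have z0 : 0 <= z by exact: normr_ge0.
      have : 0 <= (x * z - x^-1) ^+ 2 by exact: sqr_ge0.
      have -> : (x * z - x^-1) ^+ 2 = x ^+ 2 * z ^+ 2 + (x ^+ 2)^-1 - 2 * z.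
        by field; rewrite gt_eqF.
      by rewrite subr_ge0; apply: le_trans; rewrite ler_peMl// ler1n.
  rewrite bounded_rv_ED ?bounded_rv_E_cst ?bounded_rv_EZ//; last 2 first.
  - exact: bounded_rvZ.
  - exact: bounded_rv_cst.
  rewrite /K mulrDl mul1r lerD2r.
  have le1 : E (fun w => (M (s i.+1) w - M (s i) w) ^+ 2) <= b * y0 / x ^+ 4.
    apply: le_trans (M_incr (ltnW (ss i))) _.
    rewrite ler_wpM2l//; first by rewrite mulr_ge0// ltW.
    by apply: le_trans (hq i); rewrite gerBl invr_ge0 ltW.
  apply: le_trans (ler_wpM2l (sqr_ge0 x) le1) _.
  by rewrite le_eqVlt; apply/orP; left; apply/eqP; field; rewrite gt_eqF.
(* [1 / x^2 <= 2 / x - 2 / (x + 1)] for [x >= 1]. *)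
have part n : \sum_(0 <= i < n) K / i.+1%:R ^+ 2 <= K * (2 - 2 / n.+1%:R).
  elim: n => [|n IH]; first by rewrite big_nil divr1 subrr mulr0.
  rewrite big_nat_recr//=; apply: le_trans (lerD IH (lexx _)) _.
  rewrite -mulrDr ler_wpM2l//.
  rewrite -(natr1 n.+1); set x : R := n.+1%:R.
  have x1 : 1 <= x by rewrite ler1n.
  rewrite -subr_ge0 [X in 0 <= X](_ : _ = (x - 1) / (x ^+ 2 * (x + 1))).
    by rewrite divr_ge0 ?subr_ge0// mulr_ge0 ?sqr_ge0//; lra.
  by field; apply/andP; split; lra.
have [|i w||L [L0 aeL EL]] := @ae_L1_cvg_of_summable_increments R d T P (fun i => M (s i)).
- by move=> i; exact: (bounded_rv_integrable P (bM (s i))).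
- by rewrite divr_ge0// ltW.
- apply: (@le_lt_trans _ _ (K * 2)%:E); last exact: ltry.
  apply: lime_le.
    by apply: is_cvg_nneseries => *; apply: integral_ge0 => *; rewrite lee_fin.
  apply: nearW => n.
  under eq_bigr do rewrite (bounded_rv_intE P (bounded_rv_norm (bD _))).
  rewrite sumEFin lee_fin; apply: le_trans (ler_sum _ (fun i _ => absD i)) _.
  apply: le_trans (part n) _; rewrite ler_wpM2l// gerBl// divr_ge0//.
exists L; split => //.
  move: aeL; apply: filterS => w cw.
  apply: (@cvg_ratio_of_grid R (Y ^~ w) a s) => //.
  - by move=> m n mn; apply: le_growth.
  - exact: growth_grid_cvg1.
have : (\int[P]_w (M (s i) w)%:E)%E @[i --> \oo] --> y0%:E.
  under eq_fun do rewrite bounded_rv_intE// M_mean.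
  exact: cvg_cst.
by move=> My0; apply: (cvg_unique (@ereal_hausdorff R) EL My0).
Qed.

End linear_reinforcement.

(** * Testing a conditional probability against simple functions *)

Lemma is_cond_prob_indic (R : realType) (d : measure_display)
    (T : measurableType d) (P : probability T R) (G : set (set T))
    (C : set T) (p : T -> R) (A : set T) :
  is_cond_prob P G C p -> measurable C -> measurable A -> G A ->
  \int[P]_w (\1_C w * \1_A w) = \int[P]_w (p w * \1_A w).
Proof.
move=> [_ _ /(_ A) PCA] mC mA GA.
rewrite /Rintegral; congr fine.
rewrite (eq_integral (fun w => (\1_(C `&` A) w)%:E)); last first.
  by move=> w _; rewrite indicI.
rewrite integral_indic//; last exact: measurableI.
rewrite setIT [LHS](PCA GA) [LHS]integral_mkcond; apply: eq_integral => w _.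
by rewrite patchE indicE; case: ifPn => _; rewrite ?mulr1 ?mulr0.
Qed.

Lemma is_cond_prob_simple (R : realType) (d : measure_display)
    (T : measurableType d) (P : probability T R) (G : set (set T))
    (C : set T) (p : T -> R) (A : nat -> set T) (x : nat -> R) (n : nat) :
  is_cond_prob P G C p -> measurable C -> bounded_rv p ->
  (forall i, measurable (A i)) -> (forall i, G (A i)) ->
  \int[P]_w (\1_C w * \sum_(i < n) x i * \1_(A i) w) =
  \int[P]_w (p w * \sum_(i < n) x i * \1_(A i) w).
Proof.
move=> hp mC bp mA GA.
have bA i : bounded_rv (\1_(A i) : T -> R) by exact: bounded_rv_indic.
have bC : bounded_rv (\1_C : T -> R) by exact: bounded_rv_indic.
pose f m w : R := \sum_(i < m) x i * \1_(A i) w.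
have fS m : f m.+1 = fun w => f m w + x m * \1_(A m) w.
  by apply/funext => w; rewrite /f big_ord_recr.
have bf m : bounded_rv (f m).
  elim: m => [|m IH].
    rewrite (_ : f 0%N = fun=> 0); first exact: bounded_rv_cst.
    by apply/funext => w; rewrite /f big_ord0.
  by rewrite fS; apply: bounded_rvD => //; exact: bounded_rvZ.
have split_last (q : T -> R) m : bounded_rv q ->
    \int[P]_w (q w * f m.+1 w) =
    \int[P]_w (q w * f m w) + x m * \int[P]_w (q w * \1_(A m) w).
  move=> bq; rewrite (_ : (fun _ => _) =
    fun w => q w * f m w + x m * (q w * \1_(A m) w)).
    rewrite bounded_rv_ED ?bounded_rv_EZ//; try exact: bounded_rvM.
    by apply: bounded_rvZ; exact: bounded_rvM.
  by apply/funext => w; rewrite fS mulrDr mulrCA.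
rewrite -/(f n); elim: n => [|n IH].
  by congr (Rintegral _ _ _); apply/funext => w; rewrite /f !big_ord0 !mulr0.
by rewrite !split_last// IH (is_cond_prob_indic hp).
Qed.

(** * The urn with a star replacement matrix *)

Lemma prob_vector_dirac (R : realType) (k : nat) (v : 'rV[R]_k) (i j : 'I_k) :
  prob_vector v -> v ord0 i = 1 -> j != i -> v ord0 j = 0.
Proof.
move=> [v0 sv] vi ji; apply/eqP; rewrite eq_le v0 andbT.
move: sv; rewrite (bigD1 i)//= vi (bigD1 j)//= => sv.
have : 0 <= \sum_(l < k | (l != i) && (l != j)) v ord0 l by exact: sumr_ge0.
by lra.
Qed.

Lemma prob_vector_le1 (R : realType) (k : nat) (v : 'rV[R]_k) (i : 'I_k) :
  prob_vector v -> v ord0 i <= 1.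
Proof.
by move=> [v0 <-]; rewrite (bigD1 i)//= lerDl; apply: sumr_ge0.
Qed.

(** For [k >= 3] the denominator is at least 2; for [k = 2] the value 1 would force
    [alpha_c = 0], that is, the excluded swap matrix. *)
Lemma star_exponent_lt1 (R : realType) (k : nat) (hk : (2 <= k)%N)
    (alpha : 'rV[R]_k) :
  prob_vector alpha ->
  (k = 2%N -> star_matrix (colour0 hk) alpha <> \matrix_(i, j) (i != j)%:R) ->
  (1 - alpha ord0 (colour0 hk)) / (k.-1)%:R < 1.
Proof.
move=> halpha hR; set c := colour0 hk.
have a0 : 0 <= alpha ord0 c by have [] := halpha.
have k1 : (0 < k.-1)%N by rewrite -ltnS prednK// ltnW.
rewrite ltr_pdivrMr ?ltr0n// mul1r.
have [k2|k2] := eqVneq k 2%N; last first.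
  apply: (@lt_le_trans _ _ 2%:R); first by lra.
  by rewrite ler_nat; lia.
rewrite [k.-1%:R](_ : _ = 1 :> R) ?k2// ltrBlDr ltrDl lt_neqAle a0 andbT.
apply/negP => /eqP alpha0; apply: (hR k2).
have only2 (i j : 'I_k) : i != c -> j != c -> i = j.
  move=> ic jc; apply/val_inj; move: ic jc; rewrite -!val_eqE /=.
  by have := ltn_ord i; have := ltn_ord j; lia.
have alpha1 j : j != c -> alpha ord0 j = 1.
  move=> jc; have [_] := halpha; rewrite (bigD1 c)//= -alpha0 add0r => <-.
  by rewrite (bigD1 j)//= big1 ?addr0// => i /andP[ic /eqP]; case; exact: only2.
apply/matrixP => i j; rewrite !mxE -/c; case: eqVneq => [->|ic].
  by have [->|jc] := eqVneq j c; rewrite -?alpha0 ?alpha1.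
have [->|jc] := eqVneq j c; first by rewrite ic.
by rewrite (only2 i j ic jc) eqxx.
Qed.

Section star_urn.
Context (R : realType) (d : measure_display) (T : measurableType d).
Context (P : probability T R) (k : nat) (hk : (2 <= k)%N).
Context (alpha u0 : 'rV[R]_k).
Context (U : nat -> T -> 'rV[R]_k) (Z : nat -> T -> 'I_k).
Hypotheses (halpha : prob_vector alpha) (hu0 : prob_vector u0).
Hypothesis hU : neg_linear_urn P (star_matrix (colour0 hk) alpha) u0 U Z.

Local Notation c := (colour0 hk).
Local Notation b := (1 - alpha ord0 c).
Local Notation h := ((k.-1)%:R : R).
Local Notation y0 := (1 - u0 ord0 c).

Let C n : set T := [set w | Z n w = c].
Let Y n w : R := n.+1%:R - U n w ord0 c.

Let urn_step_entry n w j :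
  U n.+1 w ord0 j = U n w ord0 j + star_matrix c alpha (Z n w) j.
Proof.
rewrite (urn_step hU) !mxE; congr (_ + _).
rewrite (bigD1 (Z n w))//= big1 ?addr0.
  by rewrite !mxE eqxx mul1r.
by move=> i iZ; rewrite !mxE eq_sym (negPf iZ) mul0r.
Qed.

Let indic_C n w : \1_(C n) w = (Z n w == c)%:R :> R.
Proof.
rewrite indicE; congr ((_ : bool)%:R).
by apply/idP/idP => [/set_mem->|/eqP Zc]//; exact: mem_set.
Qed.

Let Y_init w : Y 0%N w = y0.
Proof. by rewrite /Y (urn_init hU). Qed.

Let Y_step n w : Y n.+1 w = Y n w + b * \1_(C n) w.
Proof.
rewrite /Y urn_step_entry mxE indic_C eqxx -(natr1 n.+1).
by case: ifP => _ /=; ring.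
Qed.

(* A noncentral colour grows only with a central draw, by [alpha_j], whereas [Y]
   then grows by [b]; multiplying by [b] avoids a division when [b = 0]. *)
Let U_noncentral n w j : j != c ->
  b * U n w ord0 j = alpha ord0 j * (Y n w - y0) + b * u0 ord0 j.
Proof.
move=> jc; elim: n => [|n IH].
  by rewrite Y_init subrr mulr0 add0r (urn_init hU).
rewrite urn_step_entry mxE mulrDr IH Y_step indic_C (negPf jc).
by case: ifP => _ /=; ring.
Qed.

(* [v] counts the central draws. *)
Let Y_values n w : exists2 v : nat, (v <= n)%N & Y n w = y0 + b * v%:R.
Proof.
elim: n => [|n [v vn Yv]]; first by exists 0%N => //; rewrite Y_init mulr0 addr0.
rewrite Y_step indic_C Yv; case: (Z n w == c).
  by exists v.+1 => //; rewrite -[v.+1%:R]natr1 mulrDr addrA.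
by exists v; [exact: leqW | rewrite mulr0 addr0].
Qed.

Let mC n : measurable (C n).
Proof. exact: (urn_draw_measurable hU). Qed.

Let bC n : bounded_rv (\1_(C n) : T -> R).
Proof. exact: bounded_rv_indic. Qed.

Let bY n : bounded_rv (Y n).
Proof. exact: bounded_rv_walk Y_init Y_step bC n. Qed.

Let p n w := Y n w / (h * n.+1%:R).

Let bp n : bounded_rv (p n).
Proof.
rewrite (_ : p n = fun w => (h * n.+1%:R)^-1 * Y n w); first exact: bounded_rvZ.
by apply/funext => w; rewrite mulrC.
Qed.

Let k1_gt0 : (0 < k.-1)%N.
Proof. by rewrite -ltnS prednK// ltnW. Qed.

Let h_gt0 : 0 < h.
Proof. by rewrite ltr0n. Qed.

Let draw_law n : is_cond_prob P (natural_filtration U n) (C n) (p n).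
Proof.
rewrite (_ : p n = fun w => (k.-1)%:R^-1 * (1 - U n w ord0 c / n.+1%:R)).
  exact: (urn_draw_law hU).
apply/funext => w; rewrite /p /Y; field.
by rewrite nat1r pnatr_eq0 /= gt_eqF.
Qed.

Let draw_mean n : \int[P]_w \1_(C n) w = \int[P]_w p n w.
Proof.
have := is_cond_prob_indic (draw_law n) (mC n) measurableT.
have GT : natural_filtration U n setT.
  apply: sub_gen_smallest; exists 0%N, c; split=> //.
  by exists setT => //; rewrite setTI preimage_setT.
move=> /(_ GT); under eq_Rintegral do rewrite indicT mulr1.
by move=> ->; under eq_Rintegral do rewrite indicT mulr1.
Qed.

(** When [alpha_c = 1] every draw adds one unit to the centre. *)
Lemma star_urn_dirac_cvg : alpha ord0 c = 1 ->
  forall w, U n w ord0 c / n.+1%:R @[n --> \oo] --> (1 : R).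
Proof.
move=> ac w.
have Yc n : Y n w = y0.
  by elim: n => [|n IH]; rewrite ?Y_init// Y_step IH ac subrr mul0r addr0.
have H := cvgB (cvg_cst (1 : R)) (cvgM (cvg_cst y0) (@cvg_harmonic R)).
rewrite mulr0 subr0 in H.
suff -> : (fun n => U n w ord0 c / n.+1%:R) =
  (fun n => 1 - y0 * n.+1%:R^-1) by exact: H.
by apply/funext => n; rewrite -(Yc n) /Y mulrBl divff// opprB addrC subrK.
Qed.

Lemma star_urn_dirac_noncentral : alpha ord0 c = 1 -> u0 ord0 c = 1 ->
  forall n w j, j != c -> U n w ord0 j = 0.
Proof.
move=> ac uc n w j jc; elim: n => [|n IH].
  by rewrite (urn_init hU) (prob_vector_dirac hu0 uc).
rewrite urn_step_entry IH add0r mxE (negPf jc).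
by rewrite (prob_vector_dirac halpha ac jc) if_same.
Qed.

Hypothesis b_gt0 : 0 < b.

Let Y_level m v : set T := [set w | Y m w = y0 + b * v%:R].

Let Y_levelE m v :
  Y_level m v = (fun w => U m w ord0 c) @^-1` [set m.+1%:R - (y0 + b * v%:R)].
Proof.
apply/seteqP; split=> w; rewrite /Y_level /Y /= => e; lra.
Qed.

Let Y_level_filtration m n v : (m <= n)%N ->
  natural_filtration U n (Y_level m v).
Proof.
move=> mn; apply: sub_gen_smallest; exists m, c; split=> //.
by exists [set m.+1%:R - (y0 + b * v%:R)] => //; rewrite setTI Y_levelE.
Qed.

Let Y_level_measurable m v : measurable (Y_level m v).
Proof.
have [mY _] := bY m.
rewrite -[Y_level m v]setTI.
exact: (mY measurableT [set y0 + b * v%:R]).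
Qed.

(* [Y m] takes finitely many values, on events of the natural filtration, so the
   conditional law of the draw can be tested against it. *)
Let Y_simple m w :
  Y m w = \sum_(v < m.+1) (y0 + b * v%:R) * \1_(Y_level m v) w.
Proof.
have [v vm Yv] := Y_values m w.
rewrite (bigD1 (Ordinal (vm : v < m.+1)%N))//= big1 ?addr0.
  by rewrite indicE mem_set ?mulr1.
move=> i iv; rewrite indicE memNset ?mulr0// /Y_level /= Yv.
move=> /addrI/(mulfI (lt0r_neq0 b_gt0))/eqP; rewrite eqr_nat => /eqP vi.
by move/eqP: iv; apply; apply/val_inj.
Qed.

Let draw_corr m n : (m <= n)%N ->
  \int[P]_w (\1_(C n) w * Y m w) = \int[P]_w (p n w * Y m w).
Proof.
move=> mn; under eq_Rintegral do rewrite Y_simple.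
under [RHS]eq_Rintegral do rewrite Y_simple.
apply: (is_cond_prob_simple (A := Y_level m) (fun v => y0 + b * v%:R) m.+1
  (draw_law n)) => // v; exact: Y_level_filtration.
Qed.

Hypothesis g_lt1 : b / h < 1.
Local Notation g := (b / h).

Let g_gt0 : 0 < g.
Proof. by rewrite divr_gt0. Qed.

Let y0_ge0 : 0 <= y0.
Proof. by rewrite subr_ge0 prob_vector_le1. Qed.

Let noncentral_mass_cvg : exists W : {RV P >-> R},
  [/\ forall w, 0 <= W w, 0 < y0 -> (0 < 'E_P[W])%E &
      {ae P, forall w, Y n w / n%:R `^ g @[n --> \oo] --> g * W w}].
Proof.
have I01 n w : \1_(C n) w = 0 :> R \/ \1_(C n) w = 1 :> R.
  by rewrite indicE; case: (_ \in _); [right | left].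
have mI n : measurable_fun setT (\1_(C n) : T -> R) by have [] := bC n.
have [L [L0 aeL EL]] := linear_reinforcement_cvg y0_ge0 b_gt0 h_gt0 (ltW g_lt1)
  Y_init Y_step mI I01 draw_mean draw_corr.
have g01 : 0 <= g <= 1 by rewrite !ltW.
have [rho rho0 hrho] := growth_powR_cvg g01.
have r0 : 0 < rho / g by rewrite divr_gt0.
(* The factor [g] in the statement is the sum of the slopes [alpha_j / h], so
   that [W] is the random factor common to the limits of all noncentral colours. *)
exists ((rho / g) \o* L); split.
- by move=> w /=; rewrite mulr_ge0// ltW.
- move=> y0_gt0; rewrite unlock.
  under eq_integral do rewrite /= mulrC EFinM.
  rewrite ge0_integralZl//; last 3 first.
  + exact/measurable_EFinP.
  + by move=> w _; rewrite lee_fin.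
  + by rewrite lee_fin ltW.
  by move: EL; rewrite unlock => ->; rewrite -EFinM lte_fin mulr_gt0.
move: aeL; apply: filterS => w cw /=.
have := cvgM cw hrho.
rewrite (_ : L w * rho = g * (L w * (rho / g))); last first.
  by field; rewrite !gt_eqF.
move=> H; suff -> : (fun n => Y n w / n%:R `^ g) =
  (fun n => Y n w / growth g n * (growth g n / n%:R `^ g)) by exact: H.
by apply/funext => n; rewrite mulrA divfK// gt_eqF// growth_gt0// ltW.
Qed.

Let central_share_cvg :
  {ae P, forall w, U n w ord0 c / n.+1%:R @[n --> \oo] --> (1 : R)}.
Proof.
have [W [_ _ aeW]] := noncentral_mass_cvg; move: aeW; apply: filterS => w cW.
have H := cvgB (cvg_cst (1 : R)) (cvgM cW (powR_div_cvg0 g_lt1)).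
rewrite mulr0 subr0 in H.
(* Shifted by one, since [n ^ g] vanishes at [n = 0] and could not be cancelled. *)
rewrite -(cvg_shiftS (fun n => U n w ord0 c / n.+1%:R)).
rewrite -(cvg_shiftS (fun n => 1 - Y n w / n%:R `^ g * (n%:R `^ g / n.+1%:R))) in H.
suff -> : (fun n => U n.+1 w ord0 c / n.+2%:R) =
  (fun n => 1 - Y n.+1 w / n.+1%:R `^ g * (n.+1%:R `^ g / n.+2%:R)) by exact: H.
apply/funext => n; rewrite mulrA divfK ?gt_eqF ?powR_gt0//.
by rewrite /Y mulrBl divff// opprB addrC subrK.
Qed.

Let noncentral_cvg : exists W : {RV P >-> R},
  [/\ forall w, 0 <= W w, 0 < y0 -> (0 < 'E_P[W])%E &
    {ae P, forall w, forall j, j != c ->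
      U n w ord0 j / n%:R `^ g @[n --> \oo] --> alpha ord0 j / h * W w}].
Proof.
have [W [W0 EW aeW]] := noncentral_mass_cvg; exists W; split=> //.
move: aeW; apply: filterS => w cW j jc.
have b0 : b != 0 by rewrite gt_eqF.
have h0 : h != 0 by rewrite gt_eqF.
have H := cvgD (cvgM (cvg_cst (alpha ord0 j / b)) cW)
  (cvgM (cvg_cst (u0 ord0 j - alpha ord0 j / b * y0)) (powRN_cvg0 g_gt0)).
rewrite mulr0 addr0 (_ : alpha ord0 j / b * (g * W w) = alpha ord0 j / h * W w) in H;
  last by field; rewrite b0 h0.
suff -> : (fun n => U n w ord0 j / n%:R `^ g) =
  (fun n => alpha ord0 j / b * (Y n w / n%:R `^ g) +
    (u0 ord0 j - alpha ord0 j / b * y0) * (n%:R `^ g)^-1) by exact: H.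
apply/funext => n; rewrite mulrA -mulrDl; congr (_ / _).
apply: (mulfI b0); rewrite U_noncentral//.
by field.
Qed.

(** The nondegenerate case [alpha_c < 1]; it holds for every initial vector, except
    that a limit of positive mean needs some initial mass outside the centre. *)
Lemma star_urn_cvg :
  {ae P, forall w, U n w ord0 c / n.+1%:R @[n --> \oo] --> (1 : R)} /\
  exists W : {RV P >-> R},
  [/\ forall w, 0 <= W w, 0 < y0 -> (0 < 'E_P[W])%E &
    {ae P, forall w, forall j, j != c ->
      U n w ord0 j / n%:R `^ g @[n --> \oo] --> alpha ord0 j / h * W w}].
Proof. by split. Qed.

End star_urn.

Unset Implicit Arguments.

Theorem theorem3 (R : realType) (d : measure_display) (T : measurableType d)
    (P : probability T R) (k : nat) (hk : (2 <= k)%N)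
    (alpha u0 : 'rV[R]_k) (halpha : prob_vector alpha) (hu0 : prob_vector u0)
    (hR : k = 2%N ->
      star_matrix (colour0 hk) alpha <> \matrix_(i, j) (i != j)%:R)
    (U : nat -> T -> 'rV[R]_k) (Z : nat -> T -> 'I_k)
    (hU : neg_linear_urn P (star_matrix (colour0 hk) alpha) u0 U Z) :
  let gamma := (1 - alpha ord0 (colour0 hk)) / (k.-1)%:R in
  [/\ {ae P, forall w,
        (fun n => U n w ord0 (colour0 hk) / n.+1%:R) @ \oo --> (1 : R)},
      gamma < 1 &
      (alpha ord0 (colour0 hk) = 1 <-> u0 ord0 (colour0 hk) = 1) ->
      exists W : {RV P >-> R},
        [/\ forall w, 0 <= W w,
            (0 < 'E_P[W])%E &
            {ae P, forall w, forall j : 'I_k, j != colour0 hk ->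
              (fun n => U n w ord0 j / n%:R `^ gamma) @ \oo -->
                alpha ord0 j / (k.-1)%:R * W w}]].
Proof.
move=> gamma; pose c := colour0 hk.
have g1 : gamma < 1 by exact: star_exponent_lt1.
have [alpha1|alpha1] := eqVneq (alpha ord0 c) 1.
  split=> //.
    by apply: nearW => w; exact: (star_urn_dirac_cvg hU alpha1).
  move=> [u1 _]; exists (cst 1); split=> //.
    by rewrite expectation_cst lte_fin.
  apply: nearW => w j jc; rewrite (prob_vector_dirac halpha alpha1 jc) !mul0r.
  under eq_fun do rewrite (star_urn_dirac_noncentral halpha hu0 hU alpha1 (u1 alpha1))// mul0r.
  exact: cvg_cst.
have b0 : 0 < 1 - alpha ord0 c.
  by rewrite subr_gt0 lt_neqAle alpha1 prob_vector_le1.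
have [share [W [W0 EW Wcv]]] := star_urn_cvg hu0 hU b0 g1.
split=> // -[_ u1]; exists W; split=> //; apply: EW.
rewrite subr_gt0 lt_neqAle prob_vector_le1// andbT.
by apply/eqP => /u1 /eqP; exact/negP.
Qed.
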